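(* Let $\mathbb{X},\mathbb{Y}$ be finite dimensional real Hilbert spaces, let $P_1:\mathbb{X}\to\mathbb{R}\cup\{\infty\}$ be a proper closed convex function, $P_2:\mathbb{Y}\to\mathbb{R}$ a continuous convex function and $\mathcal{A}:\mathbb{X}\to\mathbb{Y}$ a linear map. Define $$f(x)=P_1(x)-P_2(\mathcal{A}x),\qquad F(x,y)=P_1(x)-\langle\mathcal{A}x,y\rangle+P_2^*(y).$$ If $F$ is a KL function with exponent $\alpha\in[0,1)$, then $f$ is a KL function with exponent $\alpha$.
   Context: $P_2^*(y):=\sup_{z\in\mathbb{Y}}\{\langle y,z\rangle-P_2(z)\}$ is the Fenchel conjugate. A function $h:\mathbb{X}\to\mathbb{R}\cup\{\infty\}$ is proper if $\operatorname{dom}h:=\{x:h(x)<\infty\}\neq\emptyset$, and closed if it is lower semicontinuous. The regular subdifferential of a proper $h$ at $x\in\operatorname{dom}h$ is $\hat\partial h(x)=\{\zeta:\liminf_{z\to x,z\ne x}\frac{h(z)-h(x)-\langle\zeta,z-x\rangle}{\|z-x\|}\ge0\}$; the (limiting) subdifferential is $\partial h(x)=\{\zeta:\exists\,x^k\to x,\ h(x^k)\to h(x),\ \zeta^k\to\zeta,\ \zeta^k\in\hat\partial h(x^k)\}$; both are empty for $x\notin\operatorname{dom}h$, and $\operatorname{dom}\partial h:=\{x:\partial h(x)\ne\emptyset\}$. Write $\operatorname{dist}(x,D):=\inf_{y\in D}\|x-y\|$ (with value $\infty$ if $D=\emptyset$). A proper closed $h$ satisfies the Kurdyka-Łojasiewicz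 (KL) property at $\hat x\in\operatorname{dom}\partial h$ with exponent $\alpha\in[0,1)$ if there exist $a\in(0,\infty]$, a neighborhood $V$ of $\hat x$ and $\bar c>0$ such that, with $\varphi(s)=\bar c s^{1-\alpha}$, $\varphi'(h(x)-h(\hat x))\operatorname{dist}(0,\partial h(x))\ge1$ for every $x\in V$ with $h(\hat x)<h(x)<h(\hat x)+a$. A proper closed $h$ is a KL function with exponent $\alpha$ if this holds (with the same $\alpha$) at every point of $\operatorname{dom}\partial h$. *)

(* Defs.v *)
From HB Require Import structures.
From mathcomp Require Import all_boot all_order all_algebra.
From mathcomp Require Import all_classical all_reals all_analysis.
From mathcomp Require Import ring lra.

Set Implicit Arguments.
Unset Strict Implicit.
Unset Printing Implicit Defensive.
Import Order.TTheory GRing.Theory Num.Theory.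
Import numFieldNormedType.Exports.

Local Open Scope classical_set_scope.
Local Open Scope ring_scope.

(* [Vector] gives finite dimension; completeness is then automatic. *)
HB.mixin Record isFinHilbert (R : realType) V
    & NormedModule R V & Vector R V := {
  inner : V -> V -> R ;
  innerDl : forall x y z : V, inner (x + y) z = inner x z + inner y z ;
  innerZl : forall (a : R) (x y : V), inner (a *: x) y = a * inner x y ;
  innerC : forall x y : V, inner x y = inner y x ;
  inner_norm : forall x : V, inner x x = `|x| ^+ 2
}.

#[short(type="finHilbertType")]
HB.structure Definition FinHilbert (R : realType) :=
  { V of NormedModule R V & Vector R V & isFinHilbert R V }.

(* The product of two Hilbert spaces, as a separate name for [X * Y] because
   the library equips [X * Y] itself with the max norm. *)
Definition hprod (X Y : Type) : Type := (X * Y)%type.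

Section Hprod.
Context (R : realType) (X Y : finHilbertType R).

HB.instance Definition _ := Vector.copy (hprod X Y) (X * Y)%type.

Definition hprod_inner (u v : hprod X Y) : R :=
  inner u.1 v.1 + inner u.2 v.2.

Definition hprod_norm (u : hprod X Y) : R :=
  Num.sqrt (`|u.1| ^+ 2 + `|u.2| ^+ 2).

Let hprod_normD (u v : hprod X Y) :
  hprod_norm (u + v) <= hprod_norm u + hprod_norm v.
Proof.
rewrite /hprod_norm.
set a := `|u.1|; set b := `|u.2|; set c := `|v.1|; set d := `|v.2|.
have [a0 b0 c0 d0] : [/\ 0 <= a, 0 <= b, 0 <= c & 0 <= d].
  by split; exact: normr_ge0.
have S0 (s t : R) : 0 <= s ^+ 2 + t ^+ 2 by rewrite addr_ge0 ?sqr_ge0.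
apply: (@le_trans _ _ (Num.sqrt ((a + c) ^+ 2 + (b + d) ^+ 2))).
  rewrite ler_sqrt ?S0// lerD// lerXn2r ?nnegrE ?addr_ge0//;
    exact: ler_normD.
rewrite -(@ler_pXn2r _ 2) ?nnegrE ?addr_ge0 ?sqrtr_ge0//.
rewrite sqr_sqrtr ?S0// [leRHS]sqrrD !sqr_sqrtr ?S0// -sqrtrM ?S0//.
set rt := Num.sqrt _.
suff : a * c + b * d <= rt by lra.
have p0 : 0 <= a * c + b * d by rewrite addr_ge0// mulr_ge0.
rewrite -[leLHS]ger0_norm// -sqrtr_sqr ler_sqrt ?mulr_ge0 ?S0//.
rewrite -subr_ge0 (_ : _ - _ = (a * d - b * c) ^+ 2) ?sqr_ge0//.
by ring.
Qed.

Let hprod_normZ (a : R) (u : hprod X Y) :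
  hprod_norm (a *: u) = `|a| * hprod_norm u.
Proof.
rewrite /hprod_norm /= !normrZ !exprMn -mulrDr sqrtrM ?sqr_ge0//.
by rewrite sqrtr_sqr normr_id.
Qed.

Let hprod_norm0_eq0 (u : hprod X Y) : hprod_norm u = 0 -> u = 0.
Proof.
case: u => x y /eqP; rewrite /hprod_norm sqrtr_eq0 /= => le0.
have /eqP : `|x| ^+ 2 + `|y| ^+ 2 = 0.
  by apply/eqP; rewrite eq_le le0 addr_ge0 ?sqr_ge0.
rewrite paddr_eq0 ?sqr_ge0// !sqrf_eq0 !normr_eq0.
by case/andP => /eqP -> /eqP ->.
Qed.

HB.instance Definition _ := Lmodule_isNormed.Build R (hprod X Y)
  hprod_normD hprod_normZ hprod_norm0_eq0.

Let hprod_innerDl (u v w : hprod X Y) :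
  hprod_inner (u + v) w = hprod_inner u w + hprod_inner v w.
Proof. by rewrite /hprod_inner /= !innerDl addrACA. Qed.

Let hprod_innerZl (a : R) (u v : hprod X Y) :
  hprod_inner (a *: u) v = a * hprod_inner u v.
Proof. by rewrite /hprod_inner /= !innerZl mulrDr. Qed.

Let hprod_innerC (u v : hprod X Y) : hprod_inner u v = hprod_inner v u.
Proof. by rewrite /hprod_inner; congr (_ + _); exact: innerC. Qed.

Let hprod_inner_norm (u : hprod X Y) : hprod_inner u u = `|u| ^+ 2.
Proof.
by rewrite /hprod_inner !inner_norm sqr_sqrtr// addr_ge0 ?sqr_ge0.
Qed.

HB.instance Definition _ := isFinHilbert.Build R (hprod X Y)
  hprod_innerDl hprod_innerZl hprod_innerC hprod_inner_norm.

End Hprod.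

Section Defs.
Context (R : realType) (V : finHilbertType R).
Implicit Types (h : V -> \bar R) (x zeta : V) (D : set V).
Local Open Scope ereal_scope.

(* Functions into R \cup {oo} are encoded as [V -> \bar R] avoiding [-oo]. *)
Definition proper_fun h := (forall x, h x != -oo) /\ (exists x, h x < +oo).

Definition econvex h := forall x y (t : R), (0 < t < 1)%R ->
  h (t *: x + (1 - t) *: y)%R <= t%:E * h x + (1 - t)%:E * h y.

Definition fenchel_conj (P : V -> R) (y : V) : \bar R :=
  ereal_sup [set (inner y z - P z)%:E | z in [set: V]].

Definition dist_set x D : \bar R := ereal_inf [set `|x - y|%:E | y in D].

Definition regular_subdiff h x : set V := [set zeta | h x < +oo /\
  0 <= limf_einf
    (fun z => (h z - h x - (inner zeta (z - x)%R)%:E) * (`|z - x|^-1)%:E)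
    x^'].

Definition subdiff h x : set V := [set zeta | h x < +oo /\
  exists (u w : nat -> V),
    [/\ u @ \oo --> x, h (u k) @[k --> \oo] --> h x, w @ \oo --> zeta &
        forall k, regular_subdiff h (u k) (w k)]].

Definition dom_subdiff h : set V := [set x | subdiff h x !=set0].

Definition desingularizing (c alpha : R) (s : R) : R := (c * s `^ (1 - alpha))%R.

Definition KL_at h (alpha : R) (xhat : V) :=
  exists (a : \bar R) (U : set V) (c : R),
    [/\ 0 < a, nbhs xhat U, (0 < c)%R &
        forall x, U x -> h xhat < h x -> h x < h xhat + a ->
          1 <= ((desingularizing c alpha)^`()%classic (fine (h x - h xhat)))%:E
               * dist_set 0%R (subdiff h x)].

Definition KL_function h (alpha : R) :=
  [/\ proper_fun h, lower_semicontinuous h &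
      forall xhat, dom_subdiff h xhat -> KL_at h alpha xhat].

End Defs.

Section DC.
Context (R : realType) (X Y : finHilbertType R).
Variables (P1 : X -> \bar R) (P2 : Y -> R) (A : {linear X -> Y}).
Local Open Scope ereal_scope.

Definition dc_fun (x : X) : \bar R := P1 x - (P2 (A x))%:E.

Definition dc_majorant (u : hprod X Y) : \bar R :=
  P1 u.1 - (inner (A u.1) u.2)%:E + fenchel_conj P2 u.2.

End DC.

(* Main.v *)
Require Import Defs.
From HB Require Import structures.
From mathcomp Require Import all_boot all_order all_algebra.
From mathcomp Require Import all_classical all_reals all_analysis.
From mathcomp Require Import ring lra.
Import Order.TTheory GRing.Theory Num.Theory.
Import numFieldNormedType.Exports.
Local Open Scope classical_set_scope.
Local Open Scope ring_scope.

(** By Fenchel-Young [F (x, y) >= f x], with equality when [y] is a subgradient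
    of [P2] at [A x]; hence a regular subgradient [zeta] of [f] at [x] gives the
    regular subgradient [(zeta, 0)] of [F] at [(x, y)]. Subgradients of [P2]
    being locally bounded with closed graph, this passes to limiting
    subgradients, for some subgradient [y] of [P2] at [A x].
    If the KL inequality for [f] failed at [xhat], there would be [x_k -> xhat]
    and subgradients [zeta_k] of [f] at [x_k] violating it with constant [k+1];
    then [zeta_k -> 0]. Along a subsequence the associated [y_k] converge to a
    subgradient [yhat] of [P2] at [A xhat], so that [(0, 0)] is a subgradient of
    [F] at [(xhat, yhat)], and the KL inequality for [F] there is violated by
    the points [(x_k, y_k)]. *)

(** * Geometry of finite dimensional Hilbert spaces *)

Section Inner.
Context {R : realType} {V : finHilbertType R}.
Implicit Types (x y z : V) (a : R).

Lemma innerDr x y z : inner x (y + z) = inner x y + inner x z.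
Proof. by rewrite innerC innerDl !(innerC _ x). Qed.

Lemma innerZr a x y : inner x (a *: y) = a * inner x y.
Proof. by rewrite innerC innerZl (innerC y). Qed.

Lemma innerNl x y : inner (- x) y = - inner x y.
Proof. by rewrite -scaleN1r innerZl mulN1r. Qed.

Lemma innerNr x y : inner x (- y) = - inner x y.
Proof. by rewrite innerC innerNl innerC. Qed.

Lemma inner0l x : inner 0 x = 0 :> R.
Proof. by rewrite -(scale0r x) innerZl mul0r. Qed.

Lemma inner0r x : inner x 0 = 0 :> R.
Proof. by rewrite innerC inner0l. Qed.

Lemma inner_suml n (u : 'I_n -> V) y :
  inner (\sum_i u i) y = \sum_i inner (u i) y.
Proof.
elim/big_ind2 : _ => [|x1 r1 x2 r2 <- <-|//]; first by rewrite inner0l.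
by rewrite innerDl.
Qed.

Lemma normD_sqr x y : `|x + y| ^+ 2 = `|x| ^+ 2 + 2 * inner x y + `|y| ^+ 2.
Proof.
by rewrite -!inner_norm !innerDl !innerDr (innerC y x); ring.
Qed.

(** Polarization reduces continuity of the inner product to continuity of the norm. *)
Lemma inner_polar x y : inner x y = 4^-1 * (`|x + y| ^+ 2 - `|x - y| ^+ 2).
Proof. by rewrite !normD_sqr innerNr normrN; lra. Qed.

Lemma inner_le_norm x y : `|inner x y| <= `|x| * `|y|.
Proof.
have [->|y0] := eqVneq y 0; first by rewrite inner0r !normr0 mulr0.
have ny : 0 < `|y| ^+ 2 by rewrite exprn_gt0// normr_gt0.
rewrite -(@ler_pXn2r _ 2) ?nnegrE ?mulr_ge0//.
rewrite real_normK ?num_real// exprMn -subr_ge0 -(pmulr_rge0 _ ny).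
(* This squared norm equals [|y|^2 (|x|^2 |y|^2 - <x, y>^2)], which is the product to be shown
   nonnegative. *)
have := sqr_ge0 `|(`|y| ^+ 2) *: x - inner x y *: y|.
rewrite normD_sqr innerNr innerZl innerZr normrN !normrZ !exprMn.
by rewrite !(real_normK (num_real _)); congr (_ <= _); ring.
Qed.

Lemma inner_cvg {T : Type} {F : set_system T} {FF : Filter F} (u v : T -> V) x y :
  u @ F --> x -> v @ F --> y -> inner (u t) (v t) @[t --> F] --> inner x y.
Proof.
move=> ux vy; rewrite inner_polar; under eq_fun do rewrite inner_polar.
apply: cvgM; first exact: cvg_cst.
by under eq_fun do rewrite !expr2; rewrite !expr2; apply: cvgB; apply: cvgM;
  apply: cvg_norm; (exact: cvgD || exact: cvgB).
Qed.

Import VectorInternalTheory.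
Local Notation n := (dim V).

Let e (i : 'I_n) : V := r2v (delta_mx 0 i).

Let r2vE (u : 'rV[R]_n) : r2v u = \sum_i u 0 i *: e i.
Proof.
by rewrite [in LHS](row_sum_delta u) linear_sum; apply: eq_bigr => i _; rewrite linearZ.
Qed.

(* The inverse of the Gram matrix expresses coordinates as inner products, so
   that Cauchy-Schwarz bounds them by the norm. *)
Let gram : 'M[R]_n := \matrix_(i, j) inner (e i) (e j).

Let mul_gram (u : 'rV[R]_n) : u *m gram = \row_j inner (r2v u) (e j).
Proof.
apply/rowP => j; rewrite !mxE r2vE inner_suml; apply: eq_bigr => i _.
by rewrite innerZl mxE.
Qed.

(** A row [u] in the kernel makes [r2v u] orthogonal to every [e j], hence to itself. *)
Let gram_unit : gram \in unitmx.
Proof.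
rewrite -row_free_unit; apply/inj_row_free => u; rewrite mul_gram => u0.
have /eqP : inner (r2v u) (r2v u) = 0.
  rewrite [X in inner _ X]r2vE innerC inner_suml big1// => i _.
  by rewrite innerZl innerC; move/rowP : u0 => /(_ i); rewrite !mxE => ->; rewrite mulr0.
rewrite inner_norm sqrf_eq0 normr_eq0 => /eqP u1.
by rewrite -(r2vK u) u1 linear0.
Qed.

Let coord_bound : exists2 C : R, 0 <= C & forall x, `|v2r x| <= C * `|x|.
Proof.
(* The norm of a row is its largest entry; summing over [i] as well gives one constant for all
   coordinates. *)
pose g := \sum_i \sum_j `|e j| * `|invmx gram j i|.
have g0 : 0 <= g by do 2 (apply: sumr_ge0 => ? _); rewrite mulr_ge0.
exists g => // x; rewrite [leLHS]/Num.Def.normr/= mx_normrE.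
apply/bigmax_leP; split=> [|[i0 i] _ /=]; first by rewrite mulr_ge0.
rewrite (ord1 i0) -(mulmxK gram_unit (v2r x)) mul_gram v2rK mxE.
apply: (le_trans (ler_norm_sum _ _ _)).
apply: (@le_trans _ _ (\sum_j `|e j| * `|invmx gram j i| * `|x|)).
  apply: ler_sum => j _; rewrite mxE normrM mulrAC ler_wpM2r//.
  by rewrite mulrC inner_le_norm.
rewrite -mulr_suml ler_wpM2r//.
rewrite /g [leRHS](bigD1 i)//= lerDl sumr_ge0// => j _.
by rewrite sumr_ge0// => k _; rewrite mulr_ge0.
Qed.

Let r2v_continuous : continuous (r2v : 'rV[R]_n -> V).
Proof.
rewrite (_ : r2v = fun u => \sum_i u 0 i *: e i); last by apply/funext => u; rewrite r2vE.
apply: continuous_big => [|i _ u]; first exact: add_continuous.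
by apply: cvgZr_tmp; [exact: nbhs_filter|exact: (@coord_continuous R 1 n 0 i u)].
Qed.

(** The map factors through coordinates: [v2r] is bounded by [coord_bound], and [f] after [r2v] is a
    finite sum of coordinates times fixed vectors. *)
Lemma finHilbert_linear_continuous (W : normedModType R) (f : {linear V -> W}) : continuous f.
Proof.
have v2r_cont : continuous (v2r : V -> 'rV[R]_n).
  apply: bounded_linear_continuous; apply/linear_boundedP.
  have [C _ HC] := coord_bound; exists C; split; first exact: num_real.
  by move=> r Cr x; apply: (le_trans (HC x)); rewrite ler_wpM2r// ltW.
have fr2v_cont : continuous (fun u : 'rV[R]_n => f (r2v u)).
  have -> : (fun u : 'rV[R]_n => f (r2v u)) = (fun u : 'rV[R]_n => \sum_i u 0 i *: f (e i)).
    apply/funext => u; rewrite r2vE linear_sum.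
    by apply: eq_bigr => i _; rewrite linearZ.
  apply: continuous_big => [|i _ u]; first exact: add_continuous.
  by apply: cvgZr_tmp; [exact: nbhs_filter|exact: (@coord_continuous R 1 n 0 i u)].
move=> x; rewrite (_ : (f : V -> W) = (fun u => f (r2v u)) \o v2r).
  by apply: continuous_comp; [exact: v2r_cont|exact: fr2v_cont].
by apply/funext => y /=; rewrite v2rK.
Qed.

(** The ball is closed and lies in the image under [r2v] of a compact ball of rows, whose radius
    comes from [|y| <= r + |x|] and [coord_bound]. *)
Lemma closed_norm_le_compact (x : V) (r : R) : compact [set y | `|y - x| <= r].
Proof.
have [C C0 HC] := coord_bound.
pose K := [set u : 'rV[R]_n | `|u| <= C * (r + `|x|)].
have cK : compact K.
  apply: bounded_closed_compact.
    exists (C * (r + `|x|)); split; first exact: num_real.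
    by move=> M CM u /= uK; apply: (le_trans uK); exact: ltW.
  rewrite (_ : K = (fun u => `|u|) @^-1` [set s | s <= C * (r + `|x|)])//.
  apply: closed_comp => [u _|]; last exact: closed_le.
  exact: norm_continuous.
apply: (@subclosed_compact _ _ (r2v @` K)).
- rewrite (_ : mkset _ = (fun y => `|y - x|) @^-1` [set s | s <= r])//.
  apply: closed_comp => [y _|]; last exact: closed_le.
  by apply: cvg_norm; apply: cvgB; [exact: cvg_id|exact: cvg_cst].
- apply: continuous_compact => //; apply: continuous_subspaceT; exact: r2v_continuous.
- move=> y /= yr; exists (v2r y); last exact: v2rK.
  rewrite /K/=; apply: (le_trans (HC _)).
  apply: ler_wpM2l => //; rewrite -lerBlDr; apply: le_trans yr.
  exact: lerB_dist.
Qed.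

End Inner.

(** * Subgradients of continuous convex functions *)

(** The index map [s] need not be increasing: [k <= s k] is enough to preserve limits. *)
Lemma cvg_subseq {T : Type} (s : nat -> nat) (u : nat -> T) (F : set_system T) :
  (forall k, (k <= s k)%N) -> u @ \oo --> F -> (u \o s) @ \oo --> F.
Proof.
move=> sk uF; apply: (@cvg_comp _ _ _ s) uF => A [N _ NA].
by exists N => // k /= Nk; apply: NA => /=; exact: leq_trans (sk k).
Qed.

Section Sequences.
Context {R : realType} {V : normedModType R}.

Lemma cvg_dist_invS (u : nat -> V) (l : V) :
  (forall k, `|u k - l| < k.+1%:R^-1) -> u @ \oo --> l.
Proof.
move=> ul; apply/cvgrPdistC_lt => e e0.
have := @near_infty_natSinv_lt R (PosNum e0).
by apply: filterS => k /=; exact: lt_trans.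
Qed.

Lemma cvg_dist_invS_trans (a b : nat -> V) (l : V) :
  (forall k, `|a k - b k| < k.+1%:R^-1) -> b @ \oo --> l -> a @ \oo --> l.
Proof.
move=> ab bl; rewrite (_ : a = (fun k => (a k - b k) + b k)); last first.
  by apply/funext => k; rewrite subrK.
rewrite -(add0r l); apply: cvgD => //.
by apply: cvg_dist_invS => k; rewrite subr0.
Qed.

(** Compactness gives a cluster point [l]; [s k] is any index from [k] on whose term is within
    [1/(k+1)] of [l]. *)
Lemma bounded_cvg_subseq (K : set V) (u : nat -> V) : compact K ->
  (\forall k \near \oo, K (u k)) ->
  exists (s : nat -> nat) (l : V),
    (forall k, (k <= s k)%N) /\ (u \o s) @ \oo --> l.
Proof.
move=> cK Ku.
have [l [Kl ul]] := cK (u @ \oo) _ Ku.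
have H (k : nat) : exists j, (k <= j)%N /\ `|u j - l| < k.+1%:R^-1.
  have [] := ul [set u j | j in [set j | (k <= j)%N]] [set y | `|y - l| < k.+1%:R^-1].
  - by exists k => // j /= kj; exists j.
  - apply/nbhs_normP; exists k.+1%:R^-1 => /=; first by rewrite invr_gt0.
    by move=> y /=; rewrite distrC.
  by move=> _ [[j kj <-] ujl]; exists j.
have [s Hs] := choice H; exists s, l; split=> [k|]; first by case: (Hs k).
by apply: cvg_dist_invS => k; case: (Hs k).
Qed.

End Sequences.

Section Subgradient.
Context {R : realType} {V : finHilbertType R}.
Variable P : V -> R.
Hypothesis P_continuous : continuous P.
Implicit Types (x y z g : V).

Definition subgradient y : set V := [set g | forall z, P y + inner g (z - y) <= P z].

Lemma subgradient_cvg (u w : nat -> V) y g :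
  u @ \oo --> y -> w @ \oo --> g -> (forall k, subgradient (u k) (w k)) ->
  subgradient y g.
Proof.
move=> uy wg uw z.
have H : P (u k) + inner (w k) (z - u k) @[k --> \oo] --> P y + inner g (z - y).
  apply: cvgD; first exact: (cvg_comp _ _ uy (P_continuous y)).
  by apply: inner_cvg => //; apply: cvgB => //; exact: cvg_cst.
by apply: (cvgr_to_le H); apply: nearW => k; exact: uw.
Qed.

(** Near [y] the function [P] stays within 1 of [P y]. A step of length [r/2] from [u k] along [w k]
    stays in that neighborhood and raises [P] by at least [r/2 * |w k|], which is therefore below 2;
    hence the bound [4/r]. *)
Lemma subgradient_bounded (u w : nat -> V) y :
  u @ \oo --> y -> (forall k, subgradient (u k) (w k)) ->
  exists r : R, \forall k \near \oo, `|w k| <= r.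
Proof.
move=> uy uw.
have /cvgr_dist_lt/(_ 1 ltr01)/nbhs_normP[r /= r0 Pr] := P_continuous y.
exists (4 * r^-1).
have r20 : 0 < r / 2 by rewrite divr_gt0.
move/cvgr_dist_lt : uy => /(_ _ r20); apply: filterS => k yuk.
have [->|wk0] := eqVneq (w k) 0.
  by rewrite normr0 mulr_ge0// invr_ge0 ltW.
have nw : 0 < `|w k| by rewrite normr_gt0.
pose z := u k + (r / 2 * `|w k|^-1) *: w k.
have := uw k z; rewrite {1}/z addrAC subrr add0r innerZr inner_norm.
have -> : r / 2 * `|w k|^-1 * `|w k| ^+ 2 = r / 2 * `|w k| by field; rewrite gt_eqF.
have yz : `|y - z| < r.
  rewrite /z opprD addrA (le_lt_trans (ler_normB _ _))//.
  rewrite normrZ normrM normfV normr_id -mulrA mulVf ?gt_eqF// mulr1.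
  by rewrite (gtr0_norm r20); lra.
have yu : `|y - u k| < r by lra.
move: (Pr _ yz) (Pr _ yu) => /=; rewrite !ltr_distl => /andP[? ?] /andP[? ?] Hk.
by rewrite ler_pdivlMr//; lra.
Qed.

Lemma subgradient_cvg_subseq (u w : nat -> V) y :
  u @ \oo --> y -> (forall k, subgradient (u k) (w k)) ->
  exists (s : nat -> nat) g, [/\ forall k, (k <= s k)%N,
    (w \o s) @ \oo --> g & subgradient y g].
Proof.
move=> uy uw; have [r Hr] := subgradient_bounded _ _ _ uy uw.
have [|s [g [sk wg]]] := bounded_cvg_subseq _ w (closed_norm_le_compact 0 r).
  by apply: filterS Hr => k /=; rewrite subr0.
exists s, g; split => //; apply: (subgradient_cvg (u \o s) (w \o s)) => //.
  exact: cvg_subseq.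
by move=> k; exact: uw.
Qed.

Hypothesis P_convex : forall x y (t : R), 0 <= t <= 1 ->
  P (t *: x + (1 - t) *: y) <= t * P x + (1 - t) * P y.

(* The minimizer [c] of [P + a |. - y|^2] over a small ball around [y] is
   interior once [a] is large, and then [2a (y - c)] is a subgradient at [c]. *)
Lemma subgradient_dense y (e : R) : 0 < e ->
  exists c g, `|c - y| < e /\ subgradient c g.
Proof.
move=> e0; pose K := [set z | `|z - y| <= e].
have cK : compact K := closed_norm_le_compact y e.
have Ky : K y by rewrite /K/= subrr normr0 ltW.
have K0 : K !=set0 by exists y.
have [m /set_mem Km Pm] := compact_EVT_min K0 cK (continuous_subspaceT P_continuous).
(* With this [a], comparing [phi c <= phi y] with [P m <= P c] gives
   [a |c - y|^2 <= P y - P m < a e^2], so [c] is interior. *)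
pose a := (P y - P m + 1) / e ^+ 2.
have Pmy : P m <= P y by apply: Pm; rewrite inE.
have e20 : 0 < e ^+ 2 by rewrite exprn_gt0.
have a0 : 0 < a by rewrite divr_gt0//; lra.
pose phi z := P z + a * `|z - y| ^+ 2.
have phi_cont : continuous phi.
  move=> z; apply: cvgD; first exact: P_continuous.
  apply: cvgM; first exact: cvg_cst.
  rewrite expr2; under eq_fun do rewrite expr2.
  by apply: cvgM; apply: cvg_norm; apply: cvgB; (exact: cvg_id || exact: cvg_cst).
have [c /set_mem Kc phic] := compact_EVT_min K0 cK (continuous_subspaceT phi_cont).
have cy : `|c - y| < e.
  have := phic y; rewrite inE => /(_ Ky); rewrite /phi subrr normr0 expr0n mulr0 addr0 => cy.
  have Pmc : P m <= P c by apply: Pm; rewrite inE.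
  rewrite -(@ltr_pXn2r _ 2) ?nnegrE ?normr_ge0 ?(ltW e0)//.
  have ae : a * e ^+ 2 = P y - P m + 1 by rewrite /a divfK ?gt_eqF.
  by rewrite -(ltr_pM2l a0) ae; lra.
exists c, ((2 * a) *: (y - c)); split => // z.
set d := c - y in cy *; set v := z - c.
have -> : inner ((2 * a) *: (y - c)) v = - (2 * a * inner d v).
  by rewrite -opprB innerZl innerNl mulrN.
(* Minimality of [c] against [x = c + t v], with convexity of [P], yields the inequality up to
   [t a |v|^2] after division by [t]. The bound [t1] keeps [x] in the ball, [t2] makes the error at
   most [eps], and the summands 1 in the denominators cover [v = 0]. *)
apply/ler_addgt0Pr => eps eps0.
pose t1 := (e - `|d|) / (`|v| + 1); pose t2 := eps / (a * `|v| ^+ 2 + 1).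
have v1 : 0 < `|v| + 1 by rewrite ltr_pwDr.
have v2 : 0 < a * `|v| ^+ 2 + 1 by rewrite ltr_pwDr// mulr_ge0// ltW.
pose t := Num.min 1 (Num.min t1 t2).
have t0 : 0 < t by rewrite !lt_min ltr01 !divr_gt0// subr_gt0.
have tle1 : t <= 1 by rewrite ge_min lexx.
have tt1 : t * `|v| <= e - `|d|.
  have : t <= t1 by rewrite !ge_min lexx orbT.
  rewrite ler_pdivlMr// mulrDr mulr1 => H; lra.
have tt2 : t * (a * `|v| ^+ 2) <= eps.
  have : t <= t2 by rewrite !ge_min lexx !orbT.
  rewrite ler_pdivlMr// mulrDr mulr1 => H; lra.
pose x := t *: z + (1 - t) *: c.
have xy : x - y = d + t *: v.
  by rewrite /x /d /v scalerBl scale1r scalerBr [X in X - y]addrCA addrAC.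
have Kx : K x.
  rewrite /K/= xy (le_trans (ler_normD _ _))// normrZ (gtr0_norm t0); lra.
have := phic x; rewrite inE => /(_ Kx); rewrite /phi xy.
rewrite (normD_sqr d) innerZr normrZ (gtr0_norm t0) -/d exprMn.
have := P_convex z c t; rewrite tle1 (ltW t0) => /(_ isT); rewrite -/x => H1 H2.
rewrite -subr_ge0 -(pmulr_rge0 _ t0).
have : t * (t * (a * `|v| ^+ 2)) <= t * eps by rewrite ler_pM2l.
by lra.
Qed.

(** Subgradients at points tending to [y], given by [subgradient_dense], have a limit along a
    subsequence, and it is a subgradient at [y]. *)
Lemma subgradient_neq0 y : subgradient y !=set0.
Proof.
have H (k : nat) : exists cg : V * V, `|cg.1 - y| < k.+1%:R^-1 /\ subgradient cg.1 cg.2.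
  have [|c [g cg]] := subgradient_dense y (k.+1%:R^-1); first by rewrite invr_gt0.
  by exists (c, g).
have [cg Hcg] := choice H.
have [||s [g [_ _ yg]]] := subgradient_cvg_subseq (fst \o cg) (snd \o cg) y.
- by apply: cvg_dist_invS => k; case: (Hcg k).
- by move=> k; case: (Hcg k).
by exists g.
Qed.

End Subgradient.

(** * Regular and limiting subdifferentials *)

Section Subdifferential.
Context {R : realType} {V : finHilbertType R}.
Variable h : V -> \bar R.
Hypothesis h_noo : forall x, h x != -oo%E.
Implicit Types (x z zeta : V).

(** In this form without quotients, regular subgradients pass from a function to one that lies above
    it and agrees at the base point. At [z = x] the inequality is an equality, so the full
    neighborhood filter may be used. *)
Lemma regular_subdiffP x zeta r : h x = r%:E ->
  regular_subdiff h x zeta <->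
  forall e : R, 0 < e -> \forall z \near x,
    ((r + inner zeta (z - x) - e * `|z - x|)%:E <= h z)%E.
Proof.
move=> hx; split.
  case=> _; rewrite hx limf_einfE => h0 e e0.
  have [|_ [U xU <-] eU] := @ereal_sup_gt _ _ (- e)%:E (lt_le_trans _ h0).
    by rewrite lte_fin oppr_lt0.
  apply: (@filterS _ (nbhs x) _ _ _ _ xU) => z Uz.
  have [->|zx] := eqVneq z x.
    by rewrite subrr inner0r normr0 mulr0 subr0 addr0 hx.
  have zx0 : 0 < `|z - x| by rewrite normr_gt0 subr_eq0.
  have := lt_le_trans eU (ereal_inf_lbound (ex_intro2 _ _ z (Uz zx) erefl)).
  rewrite lte_pdivlMr//; case: (h z) (h_noo z) => [s| |]// _; last by rewrite leey.
  by rewrite -EFinM -!EFinB lte_fin lee_fin => H; lra.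
move=> H; split; first by rewrite hx ltry.
rewrite hx limf_einfE; apply/lee_addgt0Pr => e e0.
rewrite -leeBlDr// sub0e; apply: le_trans (ereal_sup_ubound _); last first.
  exists [set z | z != x /\ ((r + inner zeta (z - x) - e * `|z - x|)%:E <= h z)%E] => //.
  by apply: (@filterS _ (nbhs x) _ _ _ _ (H e e0)) => z.
apply: le_ereal_inf_tmp => _ [z [zx Hz] <-].
have zx0 : 0 < `|z - x| by rewrite normr_gt0 subr_eq0.
rewrite lee_pdivlMr//; case: (h z) Hz => [s| |]//.
  by rewrite -EFinM -!EFinB !lee_fin => Hs; lra.
by move=> _; rewrite !addye// leey.
Qed.

(** Diagonal argument: the [k]-th subgradient is replaced by a regular one whose point, value and
    vector are all within [1/(k+1)]. *)
Lemma subdiff_closed (u w : nat -> V) x zeta : (h x < +oo)%E ->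
  u @ \oo --> x -> h (u k) @[k --> \oo] --> h x -> w @ \oo --> zeta ->
  (forall k, subdiff h (u k) (w k)) -> subdiff h x zeta.
Proof.
move=> hx ux hux wz uw.
have fin z : (h z < +oo)%E -> h z = (fine (h z))%:E.
  by move=> hz; rewrite fineK// fin_numE h_noo/= -ltey.
have H (k : nat) : exists p : V * V, [/\ `|p.1 - u k| < k.+1%:R^-1,
    `|p.2 - w k| < k.+1%:R^-1, `|fine (h p.1) - fine (h (u k))| < k.+1%:R^-1
    & regular_subdiff h p.1 p.2].
  have [huk [u' [w' [u'u hu' w'w reg]]]] := uw k.
  have k0 : 0 < k.+1%:R^-1 :> R by rewrite invr_gt0.
  move: hu'; rewrite (fin _ huk) => /fine_cvg/cvgr_distC_lt/(_ _ k0) hu'.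
  move/cvgr_distC_lt : u'u => /(_ _ k0) u'u.
  move/cvgr_distC_lt : w'w => /(_ _ k0) w'w.
  have [j [[? ?] ?]] := filter_ex (filterI (filterI u'u w'w) hu').
  by exists (u' j, w' j); split => //; exact: reg.
have [p Hp] := choice H.
split => //; exists (fst \o p), (snd \o p); split.
- by apply: (cvg_dist_invS_trans _ _ _ _ ux) => k; case: (Hp k).
- rewrite (fin _ hx); apply: cvg_EFin.
    by apply: nearW => k /=; have [_ _ _ [/fin -> _]] := Hp k.
  apply: (cvg_dist_invS_trans _ (fun k => fine (h (u k)))) => [k|]; first by case: (Hp k).
  by apply: fine_cvg; rewrite -(fin _ hx).
- by apply: (cvg_dist_invS_trans _ _ _ _ wz) => k; case: (Hp k).
- by move=> k; case: (Hp k).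
Qed.

End Subdifferential.

(** * Norm comparison and convergence in the Hilbert product *)

Section HprodTopology.
Context {R : realType} {X Y : finHilbertType R}.
Implicit Types (u v : hprod X Y).

Lemma hprod_norm_ge1 u : `|u.1| <= `|u|.
Proof.
rewrite -(@ler_pXn2r _ 2) ?nnegrE// -[leRHS]inner_norm -inner_norm.
by rewrite [leRHS]/inner/= /hprod_inner lerDl inner_norm exprn_ge0.
Qed.

Lemma hprod_norm_le u : `|u| <= `|u.1| + `|u.2|.
Proof.
rewrite -(@ler_pXn2r _ 2) ?nnegrE ?addr_ge0// -[leLHS]inner_norm.
rewrite [leLHS]/inner/= /hprod_inner !inner_norm sqrrD.
by rewrite lerD2r lerDl mulrn_wge0// mulr_ge0.
Qed.

Lemma hprod_cvg {T : Type} {F : set_system T} {FF : Filter F}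
    (a : T -> X) (b : T -> Y) x y : a @ F --> x -> b @ F --> y ->
  ((a t, b t) : hprod X Y) @[t --> F] --> ((x, y) : hprod X Y).
Proof.
move=> ax bly; apply/cvgrPdist_lt => e e0.
have e20 : 0 < e / 2 by rewrite divr_gt0.
move/cvgr_dist_lt : ax => /(_ _ e20) ax; move/cvgr_dist_lt : bly => /(_ _ e20) bly.
apply: filterS2 ax bly => t at_ bt; apply: (le_lt_trans (hprod_norm_le _)).
by rewrite (splitr e) ltrD.
Qed.

Lemma hprod_fst_cvg u : v.1 @[v --> u] --> u.1.
Proof.
apply/(@cvgrPdist_lt _ _ _ (nbhs u)) => e e0; apply/nbhs_normP; exists e => // v /=.
by apply: le_lt_trans; exact: (hprod_norm_ge1 (u - v)).
Qed.

End HprodTopology.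

(** * The majorant and the KL property *)

Lemma desingularizing_derive1 (R : realType) (c alpha s : R) : 0 < s ->
  (desingularizing c alpha)^`()%classic s = c * ((1 - alpha) * s `^ (- alpha)).
Proof.
move=> s0; rewrite derive1E.
rewrite (_ : desingularizing c alpha = c *: (fun t : R => t `^ (1 - alpha))); last first.
  by apply/funext => t; rewrite /desingularizing.
have [? dE] := is_derive1_powR (1 - alpha) s0.
by rewrite deriveZ// dE [1 - alpha - 1]addrAC subrr add0r.
Qed.

Section DCMajorant.
Context {R : realType} {X Y : finHilbertType R}.
Variables (P1 : X -> \bar R) (P2 : Y -> R) (A : {linear X -> Y}).
Hypothesis P1_noo : forall x, P1 x != -oo%E.
Hypothesis P2_continuous : continuous P2.
Hypothesis P2_convex : convex_function [set: Y] P2.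
Local Notation f := (dc_fun P1 P2 A).
Local Notation F := (dc_majorant P1 P2 A).

Lemma convex_functionE (x y : Y) (t : R) : 0 <= t <= 1 ->
  P2 (t *: x + (1 - t) *: y) <= t * P2 x + (1 - t) * P2 y.
Proof.
move=> /andP[t0 t1].
by have := P2_convex (Itv01 t0 t1) x y; rewrite !inE => /(_ I I).
Qed.

Lemma dc_fun_noo x : f x != -oo%E.
Proof. by rewrite /dc_fun; case: (P1 x) (P1_noo x). Qed.

(** Fenchel-Young: the supremum in the conjugate is at least its term at [A u.1]. *)
Lemma dc_fun_le_majorant (u : hprod X Y) : (f u.1 <= F u)%E.
Proof.
rewrite /dc_fun /dc_majorant.
apply: (@le_trans _ _ (P1 u.1 - (inner (A u.1) u.2)%:E +
    (inner u.2 (A u.1) - P2 (A u.1))%:E)%E).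
  rewrite innerC -addeA -EFinN -EFinD leeD2l// lee_fin; lra.
by rewrite leeD2l//; apply: ereal_sup_ubound; exists (A u.1).
Qed.

Lemma dc_majorant_noo (u : hprod X Y) : F u != -oo%E.
Proof.
by rewrite -ltNye (lt_le_trans _ (dc_fun_le_majorant u))// ltNye dc_fun_noo.
Qed.

(** The subgradient inequality says that the supremum in the conjugate at [y] is attained at
    [A x]. *)
Lemma dc_majorant_subgradient x y : subgradient P2 (A x) y -> F (x, y) = f x.
Proof.
move=> xy; apply/eqP; rewrite eq_le (dc_fun_le_majorant (x, y)) andbT.
rewrite /dc_fun /dc_majorant/=.
apply: (@le_trans _ _ (P1 x - (inner (A x) y)%:E + (inner y (A x) - P2 (A x))%:E)%E).
  rewrite leeD2l//; apply: ge_ereal_sup => _ [z _ <-]; rewrite lee_fin.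
  by have := xy z; rewrite innerDr innerNr; lra.
by rewrite innerC -addeA -EFinN -EFinD leeD2l// lee_fin; lra.
Qed.

(** [F] lies above [f] composed with the first projection and agrees with it at [(x, y)], so it
    inherits the first-order minorant; the error term only grows because the product norm dominates
    that of the first component. *)
Lemma regular_subdiff_majorant x y zeta : subgradient P2 (A x) y ->
  regular_subdiff f x zeta -> regular_subdiff F ((x, y) : hprod X Y) (zeta, 0).
Proof.
move=> xy reg.
have [r fx] : exists r, f x = r%:E.
  by exists (fine (f x)); rewrite fineK// fin_numE dc_fun_noo/= -ltey; case: reg.
have Fx : F (x, y) = r%:E by rewrite dc_majorant_subgradient.
apply/(regular_subdiffP _ dc_majorant_noo _ _ _ Fx) => e e0.
move/(regular_subdiffP _ dc_fun_noo _ _ _ fx)/(_ e e0) : reg => reg.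
apply: (@filterS _ (nbhs ((x, y) : hprod X Y)) _ _ _ _
  (hprod_fst_cvg ((x, y) : hprod X Y) _ reg)) => u /= Hu.
apply: le_trans (le_trans Hu (dc_fun_le_majorant u)); rewrite lee_fin.
rewrite [in leLHS]/inner/= /hprod_inner/= inner0l addr0 lerD2l lerN2.
by apply: ler_wpM2l (ltW e0) _ _ _; exact: (hprod_norm_ge1 (u - (x, y))).
Qed.

Lemma subdiff_majorant x zeta : subdiff f x zeta ->
  exists y, subgradient P2 (A x) y /\ subdiff F ((x, y) : hprod X Y) (zeta, 0).
Proof.
move=> [fx [u [w [ux fux wz uw]]]].
have [g Hg] := choice (fun k => subgradient_neq0 _ P2_continuous convex_functionE (A (u k))).
have Au : A (u k) @[k --> \oo] --> A x.
  exact: (cvg_comp _ _ ux (finHilbert_linear_continuous _ A x)).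
have [s [y [ks gy xy]]] := subgradient_cvg_subseq _ P2_continuous _ _ _ Au Hg.
exists y; split => //; split; first by rewrite dc_majorant_subgradient.
exists (fun k => (u (s k), g (s k))), (fun k => (w (s k), 0)); split.
- by apply: hprod_cvg => //; exact: (cvg_subseq s u).
- rewrite dc_majorant_subgradient//.
  under eq_fun do rewrite dc_majorant_subgradient//.
  exact: (cvg_subseq s (fun k => f (u k))).
- by apply: hprod_cvg; [exact: (cvg_subseq s w)|exact: cvg_cst].
- by move=> k; apply: regular_subdiff_majorant.
Qed.

Lemma dc_fun_proper : (exists x, P1 x < +oo)%E -> proper_fun f.
Proof.
move=> [x Px]; split; first exact: dc_fun_noo.
by exists x; rewrite /dc_fun; case: (P1 x) Px => // r _; rewrite -EFinB ltry.
Qed.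

Lemma dc_fun_lsc : lower_semicontinuous P1 -> lower_semicontinuous f.
Proof.
move=> lsc x a; rewrite /dc_fun => afx.
(* The excess of [b] over [a + P2 (A x)] is the room left for the variation of [P2] after [A] near
   [x]. *)
have [b ab bP1] : exists2 b, a + P2 (A x) < b & (b%:E < P1 x)%E.
  case: (P1 x) (P1_noo x) afx => // [r|] _; last first.
    by exists (a + P2 (A x) + 1); [lra|exact: ltry].
  rewrite -EFinB lte_fin => ar; exists ((a + P2 (A x) + r) / 2); first by lra.
  by rewrite lte_fin; lra.
have [U xU UP1] := lsc x b bP1.
have P2A : P2 (A z) @[z --> x] --> P2 (A x).
  exact: (cvg_comp _ _ (finHilbert_linear_continuous _ A x) (P2_continuous (A x))).
have ba : 0 < b - a - P2 (A x) by lra.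
exists (U `&` [set z | `|P2 (A x) - P2 (A z)| < b - a - P2 (A x)]).
  apply: filterI => //.
  exact: (@cvgr_dist_lt _ _ _ (nbhs x) _ _ _ P2A _ ba).
move=> z [/UP1 bz /=]; rewrite ltr_distl => /andP[Hz _].
apply: (@lt_trans _ _ (b - P2 (A z))%:E); first by rewrite lte_fin; lra.
by rewrite EFinB lteD2rE.
Qed.

End DCMajorant.

(* A failure of the KL inequality for every choice [a = 1/(k+1)], [U = ball of
   radius 1/(k+1)], [c = k+1] produces subgradients that tend to zero. *)
Lemma not_KL_at_seq (R : realType) (V : finHilbertType R) (h : V -> \bar R)
    (alpha : R) (xhat : V) : (forall x, h x != -oo%E) ->
  0 <= alpha -> alpha < 1 -> (h xhat < +oo)%E -> ~ KL_at h alpha xhat ->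
  exists (x w : nat -> V) (s : nat -> R),
    [/\ x @ \oo --> xhat, w @ \oo --> 0, s @ \oo --> (0 : R),
        forall k, 0 < s k /\ h (x k) = (h xhat + (s k)%:E)%E &
        forall k, subdiff h (x k) (w k) /\
          k.+1%:R * ((1 - alpha) * s k `^ (- alpha)) * `|w k| < 1].
Proof.
move=> h_noo a0 a1 hxhat nKL.
have fin : h xhat = (fine (h xhat))%:E by rewrite fineK// fin_numE h_noo/= -ltey.
have H (k : nat) : exists p : V * V * R,
  [/\ `|p.1.1 - xhat| < k.+1%:R^-1, 0 < p.2 < k.+1%:R^-1,
      h p.1.1 = (h xhat + p.2%:E)%E, subdiff h p.1.1 p.1.2 &
      k.+1%:R * ((1 - alpha) * p.2 `^ (- alpha)) * `|p.1.2| < 1].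
  apply: contrapT => Hk; apply: nKL.
  have k0 : 0 < k.+1%:R^-1 :> R by rewrite invr_gt0.
  exists k.+1%:R^-1%:E, [set x | `|x - xhat| < k.+1%:R^-1], k.+1%:R; split => //.
    by apply/nbhs_normP; exists k.+1%:R^-1 => //= x /=; rewrite distrC.
  move=> x /= xk hx1 hx2; rewrite leNgt; apply/negP => Hlt; apply: Hk.
  have [s hs] : exists s, h x = (h xhat + s%:E)%E.
    move: hx2; rewrite fin; case: (h x) (h_noo x) => [t| |]// _ _.
    by exists (t - fine (h xhat)); rewrite -EFinD; congr EFin; rewrite addrC subrK.
  have s0 : 0 < s by move: hx1; rewrite hs fin -EFinD lte_fin ltrDl.
  have sk : s < k.+1%:R^-1 by move: hx2; rewrite hs fin -!EFinD lte_fin ltrD2l.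
  move: Hlt; have -> : fine (h x - h xhat) = s.
    by rewrite hs fin/= addrAC subrr add0r.
  rewrite desingularizing_derive1//; set d := k.+1%:R * _.
  have d0 : 0 < d by rewrite !mulr_gt0// ?powR_gt0// ?subr_gt0.
  (* A distance below [1/d] yields a subgradient of norm below [1/d]; an empty subdifferential, at
     distance [+oo], cannot violate the inequality. *)
  rewrite muleC -lte_pdivlMr// mul1e => /ereal_inf_lt[_ [w xw <-]].
  rewrite sub0r normrN lte_fin => wd.
  exists (x, w, s); split => //=; first by rewrite s0.
  by rewrite mulrC -ltr_pdivlMr// div1r.
have [p Hp] := choice H.
exists (fun k => (p k).1.1), (fun k => (p k).1.2), (fun k => (p k).2).
have s_cvg : (p k).2 @[k --> \oo] --> (0 : R).
  apply: cvg_dist_invS => k; have [_ /andP[p0 pk] _ _ _] := Hp k.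
  by rewrite subr0 gtr0_norm.
split => //.
- by apply: cvg_dist_invS => k; case: (Hp k).
- apply/cvgrPdistC_lt => e e0.
  have ae0 : 0 < e * (1 - alpha) by rewrite mulr_gt0// subr_gt0.
  have := @near_infty_natSinv_lt R (PosNum ae0); apply: filterS => k /= ke.
  have [_ /andP[p0 pk] _ _ Hw] := Hp k; rewrite subr0.
  have k0 : 0 < k.+1%:R :> R by [].
  have pow1 : 1 <= (p k).2 `^ (- alpha).
    rewrite -(powRr0 (p k).2) ger_powR ?oppr_le0// p0/= (le_trans (ltW pk))//.
    by rewrite invf_le1// ler1n.
  have a10 : 0 < 1 - alpha by rewrite subr_gt0.
  have Hw1 : k.+1%:R * (1 - alpha) * `|(p k).1.2| < 1.
    apply: le_lt_trans Hw; rewrite ler_wpM2r// ler_wpM2l//.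
    by rewrite ler_peMr// ltW.
  rewrite -(ltr_pM2l (mulr_gt0 k0 a10)); apply: (lt_trans Hw1).
  move: ke; rewrite -(ltr_pM2l k0) mulfV ?gt_eqF// => ke.
  by apply: (lt_le_trans ke); rewrite -mulrA (mulrC e).
- by move=> k; have [_ /andP[]] := Hp k.
- by move=> k; case: (Hp k).
Qed.

Theorem theorem5p1 (R : realType) (X Y : finHilbertType R)
    (P1 : X -> \bar R) (P2 : Y -> R) (A : {linear X -> Y}) (alpha : R)
    (P1_proper : proper_fun P1) (P1_closed : lower_semicontinuous P1)
    (P1_convex : econvex P1)
    (P2_continuous : continuous P2)
    (P2_convex : convex_function [set: Y] P2)
    (alpha_ge0 : 0 <= alpha) (alpha_lt1 : alpha < 1) :
  KL_function (dc_majorant P1 P2 A) alpha ->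
  KL_function (dc_fun P1 P2 A) alpha.
Proof.
case=> _ _ KLF; have [P1_noo P1_dom] := P1_proper.
have f_noo := dc_fun_noo _ P2 A P1_noo.
split; [exact: dc_fun_proper|exact: dc_fun_lsc|move=> xhat [z [fxhat _]]].
apply: contrapT => nKL.
have [x [w [s [xx ww ss Hs Hw]]]] :=
  not_KL_at_seq _ _ _ _ _ f_noo alpha_ge0 alpha_lt1 fxhat nKL.
set f := dc_fun P1 P2 A in fxhat f_noo nKL Hs Hw *.
set F := dc_majorant P1 P2 A in KLF *.
have fin : f xhat = (fine (f xhat))%:E by rewrite fineK// fin_numE f_noo/= -ltey.
have [y Hy] := choice (fun k => subdiff_majorant _ _ A P1_noo P2_continuous P2_convex
  _ _ (proj1 (Hw k))).
have Ax : A (x k) @[k --> \oo] --> A xhat.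
  exact: (cvg_comp _ _ xx (finHilbert_linear_continuous _ A xhat)).
have [t [yhat [kt yy xy]]] :=
  subgradient_cvg_subseq _ P2_continuous _ _ _ Ax (fun k => proj1 (Hy k)).
have Fhat : F (xhat, yhat) = f xhat by rewrite /F dc_majorant_subgradient.
have Fxy k : F (x k, y k) = (f xhat + (s k)%:E)%E.
  by rewrite -(proj2 (Hs k)); apply: dc_majorant_subgradient => //; case: (Hy k).
have xyt : ((x (t k), y (t k)) : hprod X Y) @[k --> \oo] --> ((xhat, yhat) : hprod X Y).
  by apply: hprod_cvg => //; exact: (cvg_subseq t x).
have st : s (t k) @[k --> \oo] --> (0 : R) by exact: (cvg_subseq t s).
have Ft : F (x (t k), y (t k)) @[k --> \oo] --> F (xhat, yhat).
  under eq_fun do rewrite Fxy fin -EFinD.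
  rewrite Fhat fin; apply: cvg_EFin; first exact: nearW.
  by rewrite -[X in _ --> X]addr0; apply: cvgD => //; exact: cvg_cst.
(* The KL property of [F] is available only where its subdifferential is nonempty; here the limit
   [(0, 0)] of the subgradients [(w (t k), 0)] is a witness. *)
have dom : dom_subdiff F ((xhat, yhat) : hprod X Y).
  exists (0, 0); apply: (subdiff_closed _ (dc_majorant_noo _ _ A P1_noo)
    (fun k => (x (t k), y (t k))) (fun k => (w (t k), 0))) => //.
  - by rewrite -/F Fhat.
  - by apply: hprod_cvg; [exact: (cvg_subseq t w)|exact: cvg_cst].
  - by move=> k; case: (Hy (t k)).
have [a [U [c [a0 xyU c0 HKL]]]] := KLF _ dom.
have near_a : \forall k \near \oo, (F (x (t k), y (t k)) < F (xhat, yhat) + a)%E.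
  case: a a0 {HKL} => [a| |]// a0; last first.
    by apply: nearW => k; rewrite Fxy Fhat fin -EFinD addey// ltry.
  move/cvgr_distC_lt : st => /(_ a a0); apply: filterS => k /=.
  rewrite subr0 => /(le_lt_trans (ler_norm _)) sa.
  by rewrite Fxy Fhat fin -!EFinD lte_fin ltrD2l.
have near_c : \forall k \near \oo, c < k.+1%:R.
  have := @near_infty_natSinv_lt R (PosNum (ltac:(by rewrite invr_gt0) : 0 < c^-1)).
  by apply: filterS => k /=; rewrite ltf_pV2 ?posrE.
have near_U : \forall k \near \oo, U (x (t k), y (t k)) := xyt _ xyU.
have [k [[Uk ak] ck]] := filter_ex (filterI (filterI near_U near_a) near_c).
have [s0 _] := Hs (t k).
have := HKL _ Uk; rewrite Fhat in ak *; rewrite -/F => /(_ _ ak).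
rewrite Fxy fin -EFinD lte_fin ltrDl => /(_ s0).
rewrite /= addrAC subrr add0r desingularizing_derive1// => one_le.
have [_ Hwk] := Hw (t k).
set d := (1 - alpha) * _ in one_le Hwk.
have d0 : 0 < d by rewrite mulr_gt0// ?subr_gt0// powR_gt0.
(* The subgradient [(w (t k), 0)] has norm [|w (t k)|], which bounds the distance in the KL
   inequality of [F]. *)
have : (1 <= (c * d)%:E * `|w (t k)|%:E)%E.
  apply: (le_trans one_le); apply: lee_wpmul2l; first by rewrite lee_fin mulr_ge0// ltW.
  apply: ereal_inf_lbound; exists (w (t k), 0); first by case: (Hy (t k)).
  rewrite sub0r normrN; congr EFin; apply/le_anti/andP; split.
    by apply: (le_trans (hprod_norm_le _)); rewrite /= normr0 addr0.
  exact: (hprod_norm_ge1 ((w (t k), 0) : hprod X Y)).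
rewrite -EFinM lee_fin leNgt => /negP; apply; apply: le_lt_trans Hwk.
(* The violated inequality carries the constant [t k + 1], and [c < k + 1 <= t k + 1] since
   [k <= t k]. *)
rewrite !ler_wpM2r ?(ltW d0)//; apply: (le_trans (ltW ck)).
by rewrite ler_nat ltnS.
Qed.
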